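(* Let $G=(V,E)$ be a finite loopless multigraph, $K\subseteq V$ with $|K|\ge2$, and $(G^1,G^2,X)$ a $K$-splitting of $(G,K)$. Then for all $\pi\in\Pi_l(X,\pi_X)$ and $i=1,2$, \[ M(G^i_\pi,K^i_\pi)=M(G^i_X,K^i_X)\sum_{\sigma\in\Pi_l(X,\pi_X)}D(G^i,\sigma)\,m(\pi\vee\sigma). \]
   Context: Labelled set partitions: for a finite set $Y$ and a symbol $l\notin Y$, a labelled set partition of $Y$ is $\pi=\{B_1\cup L_1,\dots,B_k\cup L_k\}$ with $\{B_1,\dots,B_k\}$ a set partition of $Y$ and $L_i\in\{\emptyset,\{l\}\}$ (labelled block iff $L_i=\{l\}$). $\Pi_l(Y)$ is the set of these, ordered by $\sigma\le\pi$ iff every block of $\sigma$ (including $l$ if present) is contained in a block of $\pi$; it is a lattice with join $\vee$. $m(\pi)=1$ if $\pi$ has exactly one labelled block, else $0$. For $\pi\in\Pi_l(W)$ and $Y\subseteq W$, $\pi\sqcap Y\in\Pi_l(Y)$ has blocks $(B\cap Y)\cup L$ for the blocks $B\cup L$ of $\pi$ with $B\cap Y\ne\emptyset$. Graphs may have parallel edges but no loops. For a graph $H$ on $W$ and $K'\subseteq W$: $M(H,K')=1$ if all of $K'$ lies in one connected component, else $0$; $\{(H,K')\}\in\Pi_l(W)$ has as blocks the vertex sets of connected components, labelled iff meeting $K'$. For $Y\subseteq W$ and a set partition $\rho$ of $Y$, $H_\rho$ identifies the vertices of each block of $\rho$ into one vertex (the block), deletes edges with both endpoints in one block and keeps all other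 edges (parallel edges kept); $H_Y=H_{\{Y\}}$. $K$-splitting: $G^i=(V^i,E^i)$ subgraphs of $G$ with $E^1\cup E^2=E$, $E^1\cap E^2=\emptyset$, $V^1\cup V^2=V$, $V^1\cap V^2=X$, $K^i:=K\cap V^i\ne\emptyset$. $K^i_X=(K^i\setminus X)\cup\{X\}$. $D(G^i,\sigma)=1$ if $\{(G^i,K^i)\}\sqcap X=\sigma$, else $0$. For $\pi=\{B_1\cup L_1,\dots,B_k\cup L_k\}\in\Pi_l(X)$: $G^i_\pi$ is the merging of $G^i$ by $\{B_1,\dots,B_k\}$ and $K^i_\pi=(K^i\setminus X)\cup\{B_j:L_j=\{l\}\text{ or }B_j\cap K^i\ne\emptyset\}$. $\pi_X\in\Pi_l(X)$ is the partition into singletons $\{x\}$, labelled iff $x\in K$; $\Pi_l(X,\pi_X)=\{\pi\in\Pi_l(X):\pi\ge\pi_X,\ \pi\text{ has a labelled block}\}$. *)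

(* Defs.v *)
From HB Require Import structures.
From mathcomp Require Import all_boot all_order.

Set Implicit Arguments.
Unset Strict Implicit.
Unset Printing Implicit Defensive.

Import Order.TTheory.

(* The label l is None : option T, so a block B \cup L is a {set option T}. *)

Section Blocks.
Variable T : finType.
Implicit Types (B Y W : {set T}) (C : {set option T}) (P : {set {set option T}}).

Definition mkblock B (b : bool) : {set option T} :=
  [set o : option T | if o is Some x then x \in B else b].

Definition unlabel C : {set T} := [set x | Some x \in C].

Definition labelled C : bool := None \in C.

(* The last conjunct says that each B_i occurs with exactly one L_i. *)
Definition is_lpartition Y P : bool :=
  partition (unlabel @: P) Y &&
  [forall C in P, forall D in P, (unlabel C == unlabel D) ==> (C == D)].

Definition lrestrict P Y : {set {set option T}} :=
  [set mkblock (unlabel C :&: Y) (labelled C)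
     | C in P & unlabel C :&: Y != set0].

Lemma unlabelK B b : unlabel (mkblock B b) = B.
Proof. by apply/setP=> x; rewrite !inE. Qed.

Lemma labelled_mkblock B b : labelled (mkblock B b) = b.
Proof. by rewrite /labelled inE. Qed.

Lemma in_unlabel C x : (x \in unlabel C) = (Some x \in C).
Proof. by rewrite inE. Qed.

Lemma mkblockK C : mkblock (unlabel C) (labelled C) = C.
Proof. by apply/setP=> -[x|]; rewrite !inE. Qed.

Lemma is_lpartitionP Y P :
  reflect [/\ forall C, C \in P -> exists2 x, x \in Y & Some x \in C,
              forall C x, C \in P -> Some x \in C -> x \in Y,
              forall x, x \in Y -> exists2 C, C \in P & Some x \in C
            & forall C D x, C \in P -> D \in P ->
                Some x \in C -> Some x \in D -> C = D]
          (is_lpartition Y P).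
Proof.
apply: (iffP andP) => [[/and3P[/eqP covP trP P0] /forall_inP injP]|].
  have subY C x : C \in P -> Some x \in C -> x \in Y.
    move=> CP xC; rewrite -covP; apply/bigcupP; exists (unlabel C).
      exact: imset_f.
    by rewrite in_unlabel.
  split=> // [C CP|x|C D x CP DP xC xD].
  - have /set0Pn[x] : unlabel C != set0.
      by apply: contraNneq P0 => <-; apply: imset_f.
    by rewrite in_unlabel => xC; exists x => //; apply: subY xC.
  - rewrite -covP => /bigcupP[_ /imsetP[C CP ->]].
    by rewrite in_unlabel; exists C.
  have /forall_inP/(_ D DP)/implyP injCD := injP C CP.
  apply/eqP/injCD/eqP.
  rewrite -(def_pblock trP (imset_f unlabel CP) (x := x)) ?in_unlabel //.
  by rewrite -(def_pblock trP (imset_f unlabel DP) (x := x)) ?in_unlabel.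
case=> neP subP covP injP; split.
  apply/and3P; split.
  - apply/eqP/setP=> x; apply/bigcupP/idP => [[_ /imsetP[C CP ->]]|].
      by rewrite in_unlabel; apply: subP.
    move=> /covP[C CP xC]; exists (unlabel C); first exact: imset_f.
    by rewrite in_unlabel.
  - apply/trivIsetP=> _ _ /imsetP[C CP ->] /imsetP[D DP ->] neCD.
    rewrite -setI_eq0; apply: contraNT neCD => /set0Pn[x].
    by rewrite inE !in_unlabel => /andP[xC xD]; rewrite (injP C D x).
  - apply/imsetP=> -[C CP C0]; have [x _] := neP C CP.
    by rewrite -in_unlabel -C0 inE.
apply/forall_inP=> C CP; apply/forall_inP=> D DP; apply/implyP=> /eqP eqCD.
have [x _ xC] := neP C CP.
by rewrite (injP C D x) // -in_unlabel -eqCD in_unlabel.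
Qed.

Lemma lrestrict_is_lpartition W P Y :
  Y \subset W -> is_lpartition W P -> is_lpartition Y (lrestrict P Y).
Proof.
move=> /subsetP sYW /is_lpartitionP[neP subP covP injP]; apply/is_lpartitionP.
split.
- move=> _ /imsetP[C + ->]; rewrite inE => /andP[CP /set0Pn[x xCY]].
  by exists x; [case/setIP: xCY | rewrite inE].
- by move=> _ x /imsetP[C _ ->]; rewrite inE => /setIP[].
- move=> x xY; have [C CP xC] := covP x (sYW x xY).
  exists (mkblock (unlabel C :&: Y) (labelled C)); last by rewrite !inE xC.
  apply: imset_f; rewrite inE CP; apply/set0Pn; exists x.
  by rewrite inE in_unlabel xC.
move=> _ _ x /imsetP[C + ->] /imsetP[D + ->]; rewrite !inE.
move=> /andP[CP _] /andP[DP _] /andP[xC _] /andP[xD _].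
by rewrite (injP C D x).
Qed.

End Blocks.

Record lpartition (T : finType) (Y : {set T}) := LPartition {
  lblocks : {set {set option T}};
  lblocksP : is_lpartition Y lblocks
}.
Arguments lblocksP {T Y} _.

HB.instance Definition _ (T : finType) (Y : {set T}) :=
  [isSub for @lblocks T Y].
HB.instance Definition _ (T : finType) (Y : {set T}) :=
  [Finite of lpartition Y by <:].

Fact lpartition_display : Order.disp_t.
Proof. exact: Order.Disp tt tt. Qed.

Section Lattice.
Variables (T : finType) (Y : {set T}).
Implicit Types p q r : lpartition Y.

Let wfP p := is_lpartitionP Y (lblocks p) (lblocksP p).

Definition lle p q : bool :=
  [forall C in lblocks p, exists D in lblocks q, C \subset D].

Lemma lleP p q :
  reflect (forall C, C \in lblocks p -> exists2 D, D \in lblocks q & C \subset D)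
          (lle p q).
Proof.
apply: (iffP forall_inP) => H C /H; first by move/exists_inP.
by move=> ?; apply/exists_inP.
Qed.

Lemma lle_refl : reflexive lle.
Proof. by move=> p; apply/lleP=> C; exists C. Qed.

Lemma lle_trans : transitive lle.
Proof.
move=> q p r /lleP pq /lleP qr; apply/lleP=> C /pq[D /qr[F Fr DF] CD].
by exists F; last exact: subset_trans CD DF.
Qed.

Lemma lle_anti : antisymmetric lle.
Proof.
suff sub p q : lle p q -> lle q p -> lblocks p \subset lblocks q.
  move=> p q /andP[pq qp]; apply: val_inj; apply/eqP.
  by rewrite eqEsubset !sub.
move=> /lleP pq /lleP qp; apply/subsetP=> C Cp.
have [D Dq CD] := pq C Cp; have [F Fp DF] := qp D Dq.
have [ne _ _ inj] := wfP p; have [x _ xC] := ne C Cp.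
have eCF : C = F.
  apply: (inj _ _ x) => //.
  by apply: (subsetP DF); apply: (subsetP CD).
suff -> : C = D by [].
by apply/eqP; rewrite eqEsubset CD eCF DF.
Qed.

HB.instance Definition _ := Order.Le_isPOrder.Build lpartition_display
  (lpartition Y) lle_refl lle_anti lle_trans.

Definition lmeet_blocks p q : {set {set option T}} :=
  [set C in [set C :&: D | C in lblocks p, D in lblocks q] | unlabel C != set0].

Fact lmeet_subproof p q : is_lpartition Y (lmeet_blocks p q).
Proof.
have [neP subP covP injP] := wfP p; have [neQ subQ covQ injQ] := wfP q.
apply/is_lpartitionP; split.
- move=> F; rewrite inE => /andP[/imset2P[C D Cp Dq ->] /set0Pn[x]].
  rewrite in_unlabel => xCD; exists x => //.
  by case/setIP: xCD => xC _; apply: subP xC.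
- move=> F x; rewrite inE => /andP[/imset2P[C D Cp Dq ->] _].
  by case/setIP=> xC _; apply: subP xC.
- move=> x xY; have [C Cp xC] := covP x xY; have [D Dq xD] := covQ x xY.
  exists (C :&: D); last by rewrite inE xC.
  rewrite inE imset2_f //=; apply/set0Pn; exists x.
  by rewrite in_unlabel inE xC.
move=> F F' x; rewrite !inE => /andP[/imset2P[C D Cp Dq ->] _].
move=> /andP[/imset2P[C' D' Cp' Dq' ->] _] /setIP[xC xD] /setIP[xC' xD'].
by rewrite (injP C C' x) // (injQ D D' x).
Qed.

Definition lmeet p q := LPartition (lmeet_subproof p q).

Lemma lmeetP r p q : lle r (lmeet p q) = lle r p && lle r q.
Proof.
apply/lleP/andP=> [le | [/lleP rp /lleP rq] C Cr].
  split; apply/lleP=> C /le[F]; rewrite inE => /andP[/imset2P[D D' Dp Dq ->] _];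
    rewrite subsetI => /andP[CD CD'].
    by exists D.
  by exists D'.
have [D Dp CD] := rp C Cr; have [D' Dq CD'] := rq C Cr.
exists (D :&: D'); last by rewrite subsetI CD.
rewrite inE imset2_f //=; have [ne _ _ _] := wfP r.
have [x _ xC] := ne C Cr; apply/set0Pn; exists x.
by rewrite in_unlabel inE (subsetP CD) // (subsetP CD').
Qed.

Definition lshare p q : rel T := fun x y =>
  [exists C in lblocks p :|: lblocks q, (Some x \in C) && (Some y \in C)].

Definition ljoin_class p q x : {set T} := [set y | connect (lshare p q) x y].

Definition ljoin_block p q x : {set option T} :=
  mkblock (ljoin_class p q x)
    [exists C in lblocks p :|: lblocks q,
       labelled C && (unlabel C :&: ljoin_class p q x != set0)].

Definition ljoin_blocks p q : {set {set option T}} :=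
  [set ljoin_block p q x | x in Y].

Lemma lshare_sym p q : connect_sym (lshare p q).
Proof.
apply: sym_connect_sym => x y; apply: eq_existsb => C.
by rewrite [(Some x \in C) && _]andbC.
Qed.

Fact ljoin_subproof p q : is_lpartition Y (ljoin_blocks p q).
Proof.
have [_ subP _ _] := wfP p; have [_ subQ _ _] := wfP q.
have clY : closed (lshare p q) (mem Y).
  have cl x y : lshare p q x y -> (x \in Y) && (y \in Y).
    move=> /exists_inP[C /setUP[] CP /andP[xC yC]].
      by rewrite !(subP C).
    by rewrite !(subQ C).
  by move=> x y /cl/andP[xY yY]; rewrite /= xY yY.
have eqc x y : connect (lshare p q) x y ->
    ljoin_class p q x = ljoin_class p q y.
  move=> xy; apply/setP=> z; rewrite !inE.
  exact: (same_connect (@lshare_sym p q) xy).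
apply/is_lpartitionP; split.
- by move=> _ /imsetP[x xY ->]; exists x => //; rewrite !inE connect0.
- move=> _ y /imsetP[x xY ->]; rewrite !inE => /(closed_connect clY).
  by rewrite /= xY => <-.
- move=> x xY; exists (ljoin_block p q x); first exact: imset_f.
  by rewrite !inE connect0.
move=> _ _ z /imsetP[x xY ->] /imsetP[y yY ->]; rewrite !inE => xz yz.
by rewrite /ljoin_block (eqc _ _ xz) (eqc _ _ yz).
Qed.

Definition ljoin p q := LPartition (ljoin_subproof p q).

Lemma ljoinP p q r : lle (ljoin p q) r = lle p r && lle q r.
Proof.
have [neP subP _ _] := wfP p; have [neQ subQ _ _] := wfP q.
have [neR subR covR injR] := wfP r.
have ub C : C \in lblocks p :|: lblocks q ->
    exists2 D, D \in lblocks (ljoin p q) & C \subset D.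
  move=> Cpq; have [x xY xC] : exists2 x, x \in Y & Some x \in C.
    by case/setUP: (Cpq) => [/neP|/neQ].
  exists (ljoin_block p q x); first exact: imset_f.
  apply/subsetP=> -[y|] yC; rewrite !inE.
    by apply: connect1; apply/exists_inP; exists C; rewrite ?xC.
  apply/exists_inP; exists C => //; rewrite /labelled yC /=.
  by apply/set0Pn; exists x; rewrite !inE xC connect0.
apply/idP/andP=> [jr | [/lleP pr /lleP qr]].
  split; apply: lle_trans jr; apply/lleP=> C Cpq; apply: ub;
    by rewrite inE Cpq ?orbT.
apply/lleP=> _ /imsetP[x xY ->]; have [D Dr xD] := covR x xY.
have inD C y : C \in lblocks p :|: lblocks q -> Some y \in C -> Some y \in D ->
    C \subset D.
  move=> Cpq yC yD.
  have [F Fr CF] : exists2 F, F \in lblocks r & C \subset F.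
    by case/setUP: Cpq => [/pr|/qr].
  by rewrite (injR D F y) // (subsetP CF).
have cl y : y \in ljoin_class p q x -> Some y \in D.
  rewrite inE => /connectP[s].
  elim: s x xY xD => [|z s IHs] u uY uD /= => [_ -> //|/andP[uz zs] ey].
  have [C Cpq /andP[uC zC]] := exists_inP uz.
  have zD : Some z \in D by apply: (subsetP (inD C u Cpq uC uD)).
  exact: (IHs z (subR D z Dr zD) zD zs ey).
exists D => //; apply/subsetP=> -[y|]; rewrite inE; first exact: cl.
move=> /exists_inP[C Cpq /andP[lC /set0Pn[y /setIP[+ /cl yD]]]].
by rewrite in_unlabel => yC; apply: (subsetP (inD C y Cpq yC yD)).
Qed.

HB.instance Definition _ := Order.POrder_MeetJoin_isLattice.Build
  lpartition_display (lpartition Y) lmeetP ljoinP.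

End Lattice.

Definition one_labelled (T : finType) (Y : {set T}) (p : lpartition Y) : nat :=
  #|[set C in lblocks p | labelled C]| == 1.

Section SingletonPartition.
Variables (T : finType) (Y K : {set T}).

Fact lsingletons_subproof :
  is_lpartition Y [set mkblock [set x] (x \in K) | x in Y].
Proof.
apply/is_lpartitionP; split.
- by move=> _ /imsetP[x xY ->]; exists x => //; rewrite !inE.
- by move=> _ x /imsetP[y yY ->]; rewrite !inE => /eqP->.
- by move=> x xY; exists (mkblock [set x] (x \in K));
    [exact: imset_f | rewrite !inE].
by move=> _ _ x /imsetP[y _ ->] /imsetP[z _ ->]; rewrite !inE => /eqP-> /eqP->.
Qed.

(* This is pi_Y. *)
Definition lsingletons : lpartition Y := LPartition lsingletons_subproof.

End SingletonPartition.

(* Pi_l(Y, p0) *)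
Definition lpartitions_above (T : finType) (Y : {set T}) (p0 : lpartition Y) :
    {set lpartition Y} :=
  [set p | (p0 <= p)%O && [exists C in lblocks p, labelled C]].

(* Loopless multigraphs: distinct edges may have the same two endpoints.  The
   value of [ends] outside [edges] is irrelevant. *)
Record mgraph (V E : finType) := MGraph {
  verts : {set V};
  edges : {set E};
  ends : E -> {set V};
  endsP : forall e, e \in edges -> ends e \subset verts /\ #|ends e| = 2
}.

Section Graphs.
Variables (V E : finType).
Implicit Types (H : mgraph V E) (K Y : {set V}).

Definition subgraph H H' : Prop :=
  [/\ verts H \subset verts H', edges H \subset edges H'
    & {in edges H, ends H =1 ends H'}].

Definition adj H : rel V :=
  fun u v => [exists e in edges H, ends H e == [set u; v]].

Definition component H v : {set V} := [set w in verts H | connect (adj H) v w].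

Definition components H : {set {set V}} := [set component H v | v in verts H].

(* M(H, K) *)
Definition all_connected H K : nat := [exists C in components H, K \subset C].

Lemma adj_sym H : connect_sym (adj H).
Proof.
by apply: sym_connect_sym => u v; apply: eq_existsb => e; rewrite setUC.
Qed.

Fact comp_lpartition_subproof H K :
  is_lpartition (verts H)
    [set mkblock C (C :&: K != set0) | C in components H].
Proof.
apply/is_lpartitionP; split.
- move=> _ /imsetP[_ /imsetP[v vH ->] ->]; exists v => //.
  by rewrite !inE vH connect0.
- by move=> _ x /imsetP[_ /imsetP[v vH ->] ->]; rewrite !inE => /andP[].
- move=> x xH; exists (mkblock (component H x) (component H x :&: K != set0)).
    by do 2!apply: imset_f.
  by rewrite !inE xH connect0.
move=> _ _ x /imsetP[_ /imsetP[u uH ->] ->] /imsetP[_ /imsetP[v vH ->] ->].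
rewrite !inE => /andP[_ ux] /andP[_ vx].
suff -> : component H u = component H v by [].
apply/setP=> w; rewrite !inE (same_connect (adj_sym H) ux).
by rewrite (same_connect (adj_sym H) vx).
Qed.

(* {(H, K)} *)
Definition comp_lpartition H K : lpartition (verts H) :=
  LPartition (comp_lpartition_subproof H K).

(* Merging: the merged graph has the vertices [inl v] for v outside the blocks
   of rho and [inr B] for B a block of rho. *)
Definition merge_vertex (rho : {set {set V}}) (v : V) : V + {set V} :=
  if v \in cover rho then inr (pblock rho v) else inl v.

Definition merge_verts (rho : {set {set V}}) H : {set V + {set V}} :=
  [set inl v | v in verts H :\: cover rho] :|: [set inr B | B in rho].

Definition merge_edges (rho : {set {set V}}) H : {set E} :=
  [set e in edges H | ~~ [exists B in rho, ends H e \subset B]].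

Fact merge_subproof rho H e : e \in merge_edges rho H ->
  merge_vertex rho @: ends H e \subset merge_verts rho H
  /\ #|merge_vertex rho @: ends H e| = 2.
Proof.
rewrite inE => /andP[eH /exists_inPn nloop].
have [/subsetP sub card2] := endsP eH; split.
  apply/subsetP=> _ /imsetP[v ve ->]; rewrite /merge_vertex !inE.
  case: ifPn => vrho; apply/orP; [right | left]; apply: imset_f.
    exact: pblock_mem.
  by rewrite inE vrho sub.
rewrite -card2; apply: card_in_imset => u v ue ve; rewrite /merge_vertex.
case: ifPn => urho; case: ifPn => vrho // [] // euv.
apply/eqP; apply: contraT => neuv.
have def_e : ends H e = [set u; v].
  apply/esym/eqP; rewrite eqEcard cards2 neuv card2 leqnn andbT.
  by apply/subsetP=> w; rewrite !inE => /orP[]/eqP->.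
have /negP[] := nloop _ (pblock_mem urho).
by rewrite def_e subUset !sub1set mem_pblock urho euv mem_pblock.
Qed.

(* H_rho *)
Definition merge (rho : {set {set V}}) H : mgraph (V + {set V})%type E :=
  MGraph (@merge_subproof rho H).

(* H_Y *)
Definition merge_set Y H := merge [set Y] H.

(* K_Y, for K = K^i and Y = X *)
Definition merge_term_set Y K : {set V + {set V}} :=
  [set inl v | v in K :\: Y] :|: [set inr Y].

(* H_pi *)
Definition lmerge Y (p : lpartition Y) H := merge (@unlabel V @: lblocks p) H.

(* K_pi *)
Definition lmerge_term Y (p : lpartition Y) K : {set V + {set V}} :=
  [set inl v | v in K :\: Y] :|:
  [set inr (unlabel C) | C in lblocks p
                       & labelled C || (unlabel C :&: K != set0)].

(* D(H, s), for s in Pi_l(Y).  By lrestrict_is_lpartition the restriction is a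
   labelled set partition of Y whenever Y is a set of vertices of H. *)
Definition restricts_to H K Y (s : lpartition Y) : nat :=
  lrestrict (lblocks (comp_lpartition H K)) Y == lblocks s.

Definition Ksplitting (G : mgraph V E) K (G1 G2 : mgraph V E) (X : {set V}) :
    Prop :=
  [/\ subgraph G1 G /\ subgraph G2 G,
      edges G1 :|: edges G2 = edges G /\ edges G1 :&: edges G2 = set0,
      verts G1 :|: verts G2 = verts G /\ verts G1 :&: verts G2 = X
    & K :&: verts G1 != set0 /\ K :&: verts G2 != set0].

End Graphs.

(* Main.v *)
Require Import Defs.
From mathcomp Require Import all_boot all_order.

Set Implicit Arguments.
Unset Strict Implicit.
Unset Printing Implicit Defensive.

(** Vertices of a merged graph are connected iff the original vertices are
   connected by steps that either follow an edge or jump inside a merged block;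
   for a merging by the blocks of [p], these jump-walks between vertices of [X]
   trace exactly the classes of [p `|` s], where [s] is the trace on [X] of the
   components of [H].  The factor [M(H_X, K_X)] says that every terminal is
   connected to [X], so that labels of [s] account for all terminals outside
   [X], and connecting all terminals of the merged graph amounts to having a
   single labelled block in [p `|` s]. *)

Lemma connect_invariant (T : finType) (r : rel T) (P : T -> Prop) (x y : T) :
  (forall u v, P u -> r u v -> P v) -> connect r x y -> P x -> P y.
Proof.
move=> step /connectP[s]; elim: s x => [|z s IHs] x /=; first by move=> _ ->.
by move=> /andP[xz zs] ey Px; apply: IHs zs ey _; apply: step xz.
Qed.

Lemma nat_of_bool_eq1 (b : bool) : b = 1 :> nat <-> b.
Proof. by case: b. Qed.

(** * Connectivity of a terminal set, tested from a base terminal *)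

Section Connectivity.
Variables (V E : finType).
Implicit Types (H : mgraph V E) (U : {set V}).

Lemma adjC H u v : adj H u v = adj H v u.
Proof. by apply: eq_existsb => e; rewrite setUC. Qed.

Lemma all_connectedP H U a : a \in U -> U \subset verts H ->
  all_connected H U = 1 <-> forall u, u \in U -> connect (adj H) a u.
Proof.
move=> aU /subsetP UH; apply: iff_trans (nat_of_bool_eq1 _) _; split.
  case/exists_inP=> _ /imsetP[v vH ->] /subsetP Uv u uU.
  have := Uv a aU; have := Uv u uU; rewrite !inE => /andP[_ vu] /andP[_ va].
  by apply: connect_trans vu; rewrite adj_sym.
move=> Ua; apply/exists_inP; exists (component H a); first exact: imset_f (UH a aU).
by apply/subsetP=> u uU; rewrite inE UH ?Ua.
Qed.

End Connectivity.

(** * Connectivity in a merged graph, read off on the original vertices *)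

Section Merging.
Variables (V E : finType).
Implicit Types (H : mgraph V E) (rho : {set {set V}}) (U Y : {set V}).

Definition merge_rel rho H : rel V :=
  fun u v => adj H u v || [exists B in rho, (u \in B) && (v \in B)].

Lemma merge_vertex_eqP rho (u v : V) : trivIset rho ->
  merge_vertex rho u = merge_vertex rho v
  <-> u = v \/ exists2 B, B \in rho & u \in B /\ v \in B.
Proof.
move=> tr; split=> [|[-> //|[B Brho [uB vB]]]]; rewrite /merge_vertex.
  case: ifPn => urho; case: ifPn => vrho // [] euv; last by left.
  right; exists (pblock rho u); first exact: pblock_mem.
  by rewrite mem_pblock urho euv mem_pblock.
have Bcov w : w \in B -> w \in cover rho by move=> wB; apply/bigcupP; exists B.
by rewrite !Bcov // !(def_pblock tr Brho).
Qed.

Lemma connect_adj_merge_rel rho H u v :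
  connect (adj H) u v -> connect (merge_rel rho H) u v.
Proof.
by apply: connect_sub => x y xy; apply: connect1; rewrite /merge_rel xy.
Qed.

Lemma connect_block_merge_rel rho H B u v :
  B \in rho -> u \in B -> v \in B -> connect (merge_rel rho H) u v.
Proof.
move=> Brho uB vB; apply: connect1; apply/orP; right.
by apply/exists_inP; exists B; rewrite ?uB.
Qed.

(** Only single edges lift: lifts of consecutive edges of a merged walk need not share an endpoint,
    only an image. *)
Lemma adj_merge_lift rho H a b : adj (Defs.merge rho H) a b ->
  exists u v, [/\ adj H u v, merge_vertex rho u = a & merge_vertex rho v = b].
Proof.
case/exists_inP=> e /=; rewrite inE => /andP[eH _] /eqP eab.
have [_ /eqP/cards2P[x [y [_ exy]]]] := endsP eH.
have xy : adj H x y by apply/exists_inP; exists e; rewrite ?exy.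
move: eab; rewrite exy imsetU1 imset_set1 => /setP eab.
have := eab a; have := eab b; have := eab (merge_vertex rho x).
have := eab (merge_vertex rho y); rewrite !inE !eqxx ?orbT /=.
(* The case [a = b] is not excluded at this point: when both are the image of one endpoint, the
   image of the other endpoint still lies in [[set a; b]]. *)
move=> /esym yab /esym xab /orP[]/eqP eb /orP[]/eqP ea.
- by exists x, y; split=> //; case/orP: yab => /eqP; congruence.
- by exists y, x; rewrite adjC; split.
- by exists x, y; split.
by exists x, y; split=> //; case/orP: xab => /eqP; congruence.
Qed.

(** Vertices with the same image differ by a block jump, which glues lifted edges into a walk.
    Conversely, each step of [merge_rel] maps to a merged edge or to a standstill. *)
Lemma connect_merge rho H u v : trivIset rho ->
  connect (adj (Defs.merge rho H)) (merge_vertex rho u) (merge_vertex rho v)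
  = connect (merge_rel rho H) u v.
Proof.
move=> tr.
have same x y : merge_vertex rho x = merge_vertex rho y ->
    connect (merge_rel rho H) x y.
  case/(merge_vertex_eqP _ _ tr) => [-> |[B Brho [xB yB]]]; first exact: connect0.
  exact: connect_block_merge_rel Brho xB yB.
apply/idP/idP.
  (* Quantifying over all preimages of [a] lets the next lifted edge start at any of them. *)
  pose P a := forall w, merge_vertex rho w = a -> connect (merge_rel rho H) u w.
  move=> uv; suff: P (merge_vertex rho v) by apply.
  apply: connect_invariant uv _ => [a b Pa|w /esym]; last exact: same.
  case/adj_merge_lift=> x [y [xy xa yb]] w wb.
  apply: connect_trans (Pa x xa) _.
  apply: connect_trans (connect_adj_merge_rel rho (connect1 xy)) _.
  by apply: same; rewrite yb.
pose P w := connect (adj (Defs.merge rho H)) (merge_vertex rho u) (merge_vertex rho w).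
move=> uv; apply: (connect_invariant (P := P)) uv (connect0 _ _) => x y.
rewrite /P => ux xy; apply: connect_trans ux _.
have jump B : B \in rho -> x \in B -> y \in B ->
    connect (adj (Defs.merge rho H)) (merge_vertex rho x) (merge_vertex rho y).
  move=> Brho xB yB.
  suff -> : merge_vertex rho x = merge_vertex rho y by exact: connect0.
  by apply/(merge_vertex_eqP _ _ tr); right; exists B.
case/orP: xy => [/exists_inP[e eH /eqP exy]|/exists_inP[B Brho /andP[xB yB]]];
  last exact: jump Brho xB yB.
(* Merging deletes an edge inside a block, but its endpoints then have equal images. *)
have [/exists_inP[B Brho]|nloop] := boolP [exists B in rho, ends H e \subset B].
  by rewrite exy subUset !sub1set => /andP[]; apply: jump.
apply: connect1; apply/exists_inP; exists e; first by rewrite inE eH.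
by rewrite /= exy imsetU1 imset_set1.
Qed.

Lemma all_connected_mergeP rho H U a : trivIset rho -> a \in U ->
  U \subset verts H ->
  all_connected (Defs.merge rho H) (merge_vertex rho @: U) = 1
  <-> forall u, u \in U -> connect (merge_rel rho H) a u.
Proof.
move=> tr aU /subsetP UH.
have sU : merge_vertex rho @: U \subset verts (Defs.merge rho H).
  apply/subsetP=> _ /imsetP[u uU ->]; rewrite /merge_vertex !inE.
  case: ifPn => urho; apply/orP; [right | left]; apply: imset_f.
    exact: pblock_mem.
  by rewrite inE urho UH.
apply: iff_trans (all_connectedP (imset_f _ aU) sU) _; split=> Ua.
  by move=> u uU; rewrite -connect_merge //; apply: Ua; apply: imset_f.
by move=> _ /imsetP[u uU ->]; rewrite connect_merge //; apply: Ua.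
Qed.

End Merging.

(** * Labelled blocks of a join *)

Section LabelledPartitions.
Variables (T : finType) (Y : {set T}).
Implicit Types p s : lpartition Y.

Definition lsupport p : {set T} :=
  [set x in Y | [exists C in lblocks p, labelled C && (Some x \in C)]].

Lemma mem_lsupport p C x :
  C \in lblocks p -> labelled C -> Some x \in C -> x \in lsupport p.
Proof.
have [_ subP _ _] := is_lpartitionP _ _ (lblocksP p).
move=> Cp lC xC; rewrite inE (subP C) //=; apply/exists_inP.
by exists C; rewrite ?lC.
Qed.

Lemma lshare_join p s x y : connect (lshare p s) x y ->
  ljoin_block p s x = ljoin_block p s y.
Proof.
move=> xy; have e : ljoin_class p s x = ljoin_class p s y.
  by apply/setP=> z; rewrite !inE (same_connect (@lshare_sym _ _ p s) xy).
by rewrite /ljoin_block e.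
Qed.

(** A class of the join carries the label exactly when it meets a labelled block of [p] or [s], so
    supports determine the labelled blocks. *)
Lemma labelled_ljoin_blocks p s :
  [set C in lblocks (p `|` s)%O | labelled C]
  = ljoin_block p s @: (lsupport p :|: lsupport s).
Proof.
apply/setP=> D; rewrite inE; apply/andP/imsetP.
  case=> /imsetP[x xY ->]; rewrite labelled_mkblock.
  case/exists_inP=> C Cps /andP[lC /set0Pn[y]].
  rewrite !inE => /andP[yC xy]; exists y; last exact: lshare_join.
  rewrite inE; case/setUP: Cps => C_in; apply/orP; [left|right];
    exact: mem_lsupport C_in lC yC.
case=> x xps ->.
have [xY [C Cps /andP[lC xC]]] : x \in Y /\
    exists2 C, C \in lblocks p :|: lblocks s & labelled C && (Some x \in C).
  case/setUP: xps; rewrite inE => /andP[xY /exists_inP[C C_in CP]]; split=> //;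
    by exists C; rewrite // inE C_in ?orbT.
split; first exact: imset_f.
rewrite labelled_mkblock; apply/exists_inP; exists C; rewrite ?lC //=.
by apply/set0Pn; exists x; rewrite !inE xC connect0.
Qed.

(** The labelled blocks are the image of the supports under [ljoin_block]; the base point [a] makes
    this image nonempty, so it has one element iff the map is constant there. *)
Lemma one_labelled_joinP p s a : a \in lsupport p :|: lsupport s ->
  one_labelled (p `|` s)%O = 1
  <-> forall u, u \in lsupport p :|: lsupport s -> connect (lshare p s) a u.
Proof.
move=> aps; rewrite /one_labelled labelled_ljoin_blocks.
apply: iff_trans (nat_of_bool_eq1 _) _; split.
  case/cards1P=> D eD u ups; have := imset_f (ljoin_block p s) ups.
  have := imset_f (ljoin_block p s) aps; rewrite eD !inE => /eqP ea /eqP eu.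
  have : Some u \in ljoin_block p s a by rewrite ea -eu !inE connect0.
  by rewrite !inE.
move=> conn; apply/cards1P; exists (ljoin_block p s a); apply/setP=> D.
rewrite inE; apply/imsetP/eqP=> [[u /conn au ->]|->]; last by exists a.
by rewrite (lshare_join au).
Qed.

End LabelledPartitions.

(** * The trace of the components on [X], and terminals of the two mergings *)

Section Trace.
Variables (V E : finType) (H : mgraph V E) (X K : {set V}).
Hypotheses (sXH : X \subset verts H) (sKH : K \subset verts H).
Hypothesis K_neq0 : K != set0.
Implicit Types p : lpartition X.

Let wfP p := is_lpartitionP X (lblocks p) (lblocksP p).

Lemma connect_component u v :
  connect (adj H) u v -> component H u = component H v.
Proof.
by move=> uv; apply/setP=> w; rewrite !inE (same_connect (adj_sym H) uv).
Qed.

Definition trace : lpartition X :=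
  LPartition (lrestrict_is_lpartition sXH (lblocksP (comp_lpartition H K))).

Definition trace_block x : {set option V} :=
  mkblock (component H x :&: X) (component H x :&: K != set0).

Lemma lblocks_trace : lblocks trace = trace_block @: X.
Proof.
apply/setP=> C; apply/imsetP/imsetP=> [[D + ->]|[x xX ->]].
  rewrite inE => /andP[/imsetP[_ /imsetP[v vH ->] ->]].
  rewrite unlabelK labelled_mkblock => /set0Pn[x].
  rewrite !inE => /andP[/andP[xH vx] xX]; exists x => //.
  by rewrite /trace_block (connect_component vx).
have xH := subsetP sXH x xX.
exists (mkblock (component H x) (component H x :&: K != set0)); last first.
  by rewrite unlabelK labelled_mkblock.
rewrite inE unlabelK; apply/andP; split; first by do 2!apply: imset_f.
by apply/set0Pn; exists x; rewrite !inE xH connect0.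
Qed.

Lemma mem_lsupport_trace x : x \in X ->
  x \in lsupport trace <-> exists2 k, k \in K & connect (adj H) x k.
Proof.
move=> xX; rewrite inE xX andTb; split.
  case/exists_inP=> C; rewrite lblocks_trace => /imsetP[y yX ->].
  rewrite labelled_mkblock !inE => /andP[/set0Pn[k]].
  rewrite !inE => /andP[/andP[_ yk] kK] /andP[/andP[_ yx] _].
  by exists k => //; apply: connect_trans yk; rewrite adj_sym.
case=> k kK xk; apply/exists_inP; exists (trace_block x).
  by rewrite lblocks_trace; apply: imset_f.
rewrite labelled_mkblock !inE xX (subsetP sXH) // connect0 !andbT.
by apply/set0Pn; exists k; rewrite !inE xk kK (subsetP sKH).
Qed.

(** Block jumps take place inside [X], so an excursion outside [X] uses edges only; when it returns,
    its two ends share a block of [trace]. *)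
Lemma connect_lshare_trace p x y : x \in X -> y \in X ->
  connect (lshare p trace) x y
  = connect (merge_rel (@unlabel V @: lblocks p) H) x y.
Proof.
move=> xX yX; have [_ subP _ _] := wfP p; apply/idP/idP.
  apply: connect_sub => {xX yX} {}x {}y.
  case/exists_inP=> C /setUP[Cp|] => [/andP[xC yC]|].
    by apply: connect_block_merge_rel (imset_f _ Cp) _ _; rewrite in_unlabel.
  rewrite lblocks_trace => /imsetP[z zX ->]; rewrite !inE.
  case/andP=> /andP[/andP[_ zx] _] /andP[/andP[_ zy] _].
  apply: connect_adj_merge_rel; apply: connect_trans zy.
  by rewrite adj_sym.
have tr u v : u \in X -> v \in X -> connect (adj H) u v ->
    connect (lshare p trace) u v.
  move=> uX vX uv; apply: connect1; apply/exists_inP; exists (trace_block u).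
    by rewrite inE lblocks_trace imset_f ?orbT.
  by rewrite !inE uX vX uv connect0 !(subsetP sXH).
(* The walk may be outside [X] at [v]; [z] is the point of [X] from which the current run of edges
   started. *)
pose P v := exists2 z, z \in X & connect (lshare p trace) x z /\ connect (adj H) z v.
move=> xy; have [||z zX [xz zy]] := connect_invariant (P := P) _ xy.
- move=> u v [z zX [xz zu]] /orP[uv|/exists_inP[_ /imsetP[C Cp ->] /andP[uC vC]]].
    by exists z => //; split=> //; apply: connect_trans zu (connect1 uv).
  move: uC vC; rewrite !in_unlabel => uC vC; exists v; first exact: subP vC.
  split; last exact: connect0.
  apply: connect_trans xz _; apply: connect_trans (tr z u zX (subP _ _ Cp uC) zu) _.
  by apply: connect1; apply/exists_inP; exists C; rewrite ?inE ?Cp // uC.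
- by exists x.
by apply: connect_trans xz (tr _ _ zX yX zy).
Qed.

Lemma merge_setP : X != set0 ->
  all_connected (merge_set X H) (merge_term_set X K) = 1
  <-> forall k, k \in K -> exists2 x, x \in X & connect (adj H) x k.
Proof.
move=> /set0Pn[a aX].
have tr : trivIset [set X] by apply/trivIsetP=> A B /set1P-> /set1P->; rewrite eqxx.
have fX x : x \in X -> merge_vertex [set X] x = inr X.
  by move=> xX; rewrite /merge_vertex cover1 xX (def_pblock tr (set11 X)).
(* All of [X] maps to the single terminal [inr X], so adding it to [K] leaves the image unchanged
   and makes [a] available as base point. *)
have -> : merge_term_set X K = merge_vertex [set X] @: (K :|: X).
  apply/setP=> b; rewrite inE; apply/orP/imsetP.
    case=> [/imsetP[k]|/set1P->].
      rewrite inE => /andP[kX kK] ->; exists k; first by rewrite inE kK.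
      by rewrite /merge_vertex cover1 (negPf kX).
    by exists a; rewrite ?fX // inE aX orbT.
  case=> u uKX ->; have [/fX->|uX] := boolP (u \in X); first by right; rewrite inE.
  left; rewrite /merge_vertex cover1 (negPf uX) imset_f //.
  by move: uKX; rewrite !inE (negPf uX) orbF.
have aKX : a \in K :|: X by rewrite inE aX orbT.
have sU : K :|: X \subset verts H by rewrite subUset sKH.
apply: iff_trans (all_connected_mergeP tr aKX sU) _; split=> conn.
  pose P v := exists2 x, x \in X & connect (adj H) x v.
  move=> k kK; have ak := conn k; rewrite inE kK in ak.
  apply: (connect_invariant (P := P)) (ak isT) _ => [u v [x xX xu]|]; last first.
    by exists a.
  case/orP=> [uv|/exists_inP[_ /set1P-> /andP[_ vX]]]; last by exists v.
  by exists x => //; apply: connect_trans xu (connect1 uv).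
have aX_conn x : x \in X -> connect (merge_rel [set X] H) a x.
  by apply: connect_block_merge_rel aX; rewrite inE.
move=> u /setUP[/conn[x xX xu]|]; last exact: aX_conn.
exact: connect_trans (aX_conn x xX) (connect_adj_merge_rel _ xu).
Qed.

(** A labelled block is the image of any of its points, and a block meeting [K] is the image of a
    terminal; hence the merged terminals pull back to [K :|: lsupport p]. *)
Lemma lmergeP p a : (lsingletons X K <= p)%O -> a \in lsupport p ->
  all_connected (lmerge p H) (lmerge_term p K) = 1
  <-> forall u, u \in K :|: lsupport p ->
        connect (merge_rel (@unlabel V @: lblocks p) H) a u.
Proof.
move=> /lleP Kp ap; set rho := [set _ | _ in _].
have [neP subP covP injP] := wfP p.
have /andP[/and3P[/eqP cov tr _] _] := lblocksP p; rewrite -/rho in cov tr.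
have fC C x : C \in lblocks p -> Some x \in C ->
    merge_vertex rho x = inr (unlabel C).
  move=> Cp xC; rewrite /merge_vertex cov (subP C) //.
  by rewrite (def_pblock tr (imset_f _ Cp)) // in_unlabel.
(* The block of [lsingletons X K] at a terminal [x] contains the label, and so does the block of [p]
   above it. *)
have sing x : x \in X -> x \in K -> x \in lsupport p.
  move=> xX xK; have [|C Cp /subsetP sC] := Kp (mkblock [set x] (x \in K)).
    exact: imset_f.
  by apply: (mem_lsupport Cp); [rewrite /labelled|]; apply: sC; rewrite !inE.
have -> : lmerge_term p K = merge_vertex rho @: (K :|: lsupport p).
  apply/setP=> b; rewrite inE; apply/orP/imsetP.
    case=> /imsetP[k].
      rewrite inE => /andP[kX kK] ->; exists k; first by rewrite inE kK.
      by rewrite /merge_vertex cov (negPf kX).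
    rewrite inE => /andP[kp /orP[lk|/set0Pn[x xkK]]] ->.
      have [x _ xk] := neP k kp; exists x; last by rewrite (fC k).
      by rewrite inE (mem_lsupport kp lk xk) orbT.
    move: xkK; rewrite inE in_unlabel => /andP[xk xK].
    by exists x; [rewrite inE xK | rewrite (fC k)].
  case=> u uKp ->; have [uX|uX] := boolP (u \in X); [right|left].
    have : u \in lsupport p by case/setUP: uKp => // /sing->.
    rewrite inE => /andP[_ /exists_inP[C Cp /andP[lC uC]]].
    by rewrite (fC C) //; apply: imset_f; rewrite inE Cp lC.
  rewrite /merge_vertex cov (negPf uX) imset_f //.
  by move: uKp; rewrite !inE (negPf uX) orbF.
apply: all_connected_mergeP => //; first by rewrite inE ap orbT.
rewrite subUset sKH /=; apply: subset_trans sXH.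
by apply/subsetP=> x; rewrite inE => /andP[].
Qed.

(** A terminal in [X] labels its own component, which gives the order relation; the nonempty support
    provides the labelled block. *)
Lemma trace_above : lsupport trace != set0 ->
  trace \in lpartitions_above (lsingletons X K).
Proof.
case/set0Pn=> x; rewrite 2!inE => /andP[xX /exists_inP[C Ct /andP[lC _]]].
apply/andP; split; last by apply/exists_inP; exists C.
apply/lleP=> _ /imsetP[y yX ->]; exists (trace_block y).
  by rewrite lblocks_trace imset_f.
have yH := subsetP sXH y yX.
apply/subsetP=> -[z|]; rewrite !inE.
  by move/eqP->; rewrite yX yH connect0.
by move=> yK; apply/set0Pn; exists y; rewrite !inE yH yK connect0.
Qed.

(** The factor [restricts_to H K s] is the indicator of [s = trace], so at most one term
    survives. *)
Lemma sum_restricts_to (A : {set lpartition X}) (F : lpartition X -> nat) :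
  \sum_(s in A) restricts_to H K s * F s = (trace \in A) * F trace.
Proof.
have D s : restricts_to H K s = (s == trace).
  by rewrite /restricts_to eq_sym.
have [tA|tA] := boolP (trace \in A).
  rewrite (bigD1 trace) //= D eqxx !mul1n big1 ?addn0 // => s /andP[_ /negPf].
  by rewrite D => ->.
rewrite big1 // => s sA; rewrite D; case: eqP => // es.
by rewrite es (negPf tA) in sA.
Qed.

Lemma all_connected_lmerge p :
  p \in lpartitions_above (lsingletons X K) ->
  all_connected (lmerge p H) (lmerge_term p K) =
  all_connected (merge_set X H) (merge_term_set X K) *
  \sum_(s in lpartitions_above (lsingletons X K))
     restricts_to H K s * one_labelled (p `|` s)%O.
Proof.
rewrite inE => /andP[Kp /exists_inP[C Cp lC]].
have [neP subP _ _] := wfP p; have [a aX aC] := neP C Cp.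
have ap := mem_lsupport Cp lC aC.
have X_neq0 : X != set0 by apply/set0Pn; exists a.
have sup_sub (q : lpartition X) x : x \in lsupport q -> x \in X.
  by rewrite inE => /andP[].
rewrite sum_restricts_to.
set t := trace; set L := all_connected _ _; set M := all_connected _ _.
have aS : a \in lsupport p :|: lsupport t by rewrite inE ap.
(* All factors are 0 or 1, so the numerical identity reduces to an equivalence of conditions. *)
suff [L_imp L_if] : L = 1 <->
    [/\ M = 1, t \in lpartitions_above (lsingletons X K)
      & one_labelled (p `|` t)%O = 1].
  move: L_imp L_if; rewrite {}/L {}/M /all_connected /one_labelled => L_imp L_if.
  rewrite !mulnb; congr (nat_of_bool _); apply/idP/and3P.
    by move/nat_of_bool_eq1/L_imp=> [? ? ?]; split=> //; apply/nat_of_bool_eq1.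
  by case=> *; apply/nat_of_bool_eq1/L_if; split=> //; apply/nat_of_bool_eq1.
have [k0 k0K] := set0Pn K K_neq0.
have supX x : x \in lsupport p :|: lsupport t -> x \in X by case/setUP; apply: sup_sub.
split.
  move/(lmergeP Kp ap) => conn.
  (* Along a walk from [a], the witness in [X] is kept at an edge and replaced by the end of the
     jump at a block jump. *)
  have toX k : k \in K -> exists2 x, x \in X & connect (adj H) x k.
    move=> kK; have ak := conn k; rewrite inE kK in ak.
    pose P (v : V) := exists2 x, x \in X & connect (adj H) x v.
    apply: (connect_invariant (P := P)) (ak isT) _ => [u v [x xX xu]|]; last first.
      by exists a.
    case/orP=> [uv|/exists_inP[_ /imsetP[D Dp ->] /andP[_]]].
      by exists x => //; apply: connect_trans xu (connect1 uv).
    by rewrite in_unlabel => /(subP D v Dp) vX; exists v.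
  split; first by apply/merge_setP.
    (* The terminal [k0] is connected to some point of [X], whose block in the trace is therefore
       labelled. *)
    apply: trace_above; apply/set0Pn; have [x xX xk0] := toX _ k0K.
    by exists x; apply/mem_lsupport_trace => //; exists k0.
  apply/(one_labelled_joinP aS) => u ups; have uX := supX u ups.
  rewrite connect_lshare_trace //; case/setUP: ups => [up|].
    by apply: conn; rewrite inE up orbT.
  case/(mem_lsupport_trace uX) => k kK uk.
  apply: connect_trans (conn k _) _; first by rewrite inE kK.
  by apply: connect_adj_merge_rel; rewrite adj_sym.
case=> /(merge_setP X_neq0) toX _ /(one_labelled_joinP aS) conn.
apply/(lmergeP Kp ap).
have S_conn x : x \in lsupport p :|: lsupport t ->
    connect (merge_rel (@unlabel V @: lblocks p) H) a x.
  by move=> xS; rewrite -connect_lshare_trace ?supX // conn.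
move=> u /setUP[uK|up]; last by apply: S_conn; rewrite inE up.
have [x xX xu] := toX u uK.
apply: connect_trans (S_conn x _) (connect_adj_merge_rel _ xu).
by rewrite inE; apply/orP; right; apply/mem_lsupport_trace => //; exists u.
Qed.

End Trace.

(** Reconciles the order bound built from all of [K] with the one built from the terminals of a
    single side of the splitting. *)
Lemma lsingletonsI (T : finType) (Y K W : {set T}) :
  Y \subset W -> lsingletons Y (K :&: W) = lsingletons Y K.
Proof.
move=> /subsetP sYW; apply: val_inj => /=; apply: eq_in_imset => x xY.
by rewrite inE sYW ?andbT.
Qed.

Theorem theorem5p18 (V E : finType) (G : mgraph V E) (K : {set V})
    (hK : K \subset verts G) (hK2 : 2 <= #|K|)
    (G1 G2 : mgraph V E) (X : {set V}) (hsplit : Ksplitting G K G1 G2 X)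
    (p : lpartition X) (hp : p \in lpartitions_above (lsingletons X K))
    (Gi : mgraph V E) (hGi : Gi = G1 \/ Gi = G2) :
  let Ki := K :&: verts Gi in
  all_connected (lmerge p Gi) (lmerge_term p Ki) =
  all_connected (merge_set X Gi) (merge_term_set X Ki) *
  \sum_(s in lpartitions_above (lsingletons X K))
     restricts_to Gi Ki s * one_labelled (p `|` s)%O.
Proof.
have [_ _ [_ capX] [K1 K2]] := hsplit.
have sXi : X \subset verts Gi.
  by case: hGi => ->; rewrite -capX ?subsetIl ?subsetIr.
have Ki_neq0 : K :&: verts Gi != set0 by case: hGi => ->.
move=> Ki; rewrite -(lsingletonsI K sXi) in hp *.
by have := all_connected_lmerge sXi (subsetIr _ _) Ki_neq0 hp; apply.
Qed.
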